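(* The free unital hyperarchimedean vector lattice on $\aleph_0$ generators, $\mathrm{LC}_{\aleph_0}=\mathrm{LC}(\{0,1\}^{\aleph_0})$, is, up to isomorphism, the unique object $(V,u)$ in $\mathsf{uHA}$ that satisfies the following conditions. (1) $(V,u)$ is non-trivial, i.e. $u\ne0$. (2) $(V,u)$ has no direct factor isomorphic to $(\mathbb{R},1)$. (3) $V$ has countably many principal polars.
   Context: A vector lattice is a lattice-ordered real vector space. A weak unit of $V$ is $u\ge0$ with $u\wedge v=0\Rightarrow v=0$ for all $v\in V$. $V$ is Archimedean if $0<v\le w$ implies $nv\not\le w$ for some positive integer $n$; it is hyperarchimedean if all its homomorphic images are Archimedean. $\mathsf{uHA}$ is the category of pairs $(V,u)$ with $V$ a hyperarchimedean vector lattice and $u$ a distinguished weak unit (which is then automatically a strong unit: each $v\ge 0$ satisfies $v\le nu$ for some $n$), with morphisms the linear lattice homomorphisms preserving the distinguished units. $\mathsf{uVL}$ is the category of vector lattices with a distinguished strong unit, with the same kind of morphisms. For a compact space $X$, $\mathrm{LC}(X)$ is the vector lattice of all locally constant functions $X\to\mathbb{R}$ with pointwise operations and unit the constant function $1_X$. For a cardinal $\kappa$, $\mathrm{LC}_\kappa=\mathrm{LC}(\{0,1\}^\kappa)$, where $\{0,1\}^\kappa$ is the product of $\kappa$ copies of the discrete space $\{0,1\}$ with the product topology; $\mathrm{LC}_\kappa$ is called the free unital hyperarchimedean vector lattice on $\kappa$ generators. A principal polar of $V$ is a set of the form $P(v)=\{w\in V\mid |v|\wedge|w|=0\}$ for some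 $v\in V$. The product of $(V,u)$ and $(V',u')$ is $(V\times V',(u,u'))$ with pointwise operations. $(V',u')$ is a direct factor of $(V'',u'')$ if there is an isomorphism $(V'',u'')\cong(V,u)\times(V',u')$ in $\mathsf{uVL}$ for some $(V,u)$. Countable means finite or countably infinite. *)

(* Defs.v *)
From HB Require Import structures.
From mathcomp Require Import all_boot all_order all_algebra.
From mathcomp Require Import all_classical all_reals all_analysis.

Set Implicit Arguments.
Unset Strict Implicit.
Unset Printing Implicit Defensive.

Import Order.TTheory GRing.Theory Num.Theory.

Local Open Scope classical_set_scope.
Local Open Scope order_scope.
Local Open Scope ring_scope.

(* Lattice-ordered vector spaces over a model R of the real numbers. The number
   structures of ssrnum already inherit from GRing.Zmodule and Order.Lattice, so
   Hierarchy-Builder rejects a new structure that inherits from both: the mixin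
   carries the order, and the Order.Lattice instance is derived from it. *)
HB.mixin Record Lmodule_isVectLattice (R : realType) V of GRing.Lmodule R V := {
  vle : rel V;
  vmeet : V -> V -> V;
  vjoin : V -> V -> V;
  vle_refl : reflexive vle;
  vle_anti : antisymmetric vle;
  vle_trans : transitive vle;
  vlexI : forall x y z : V, vle x (vmeet y z) = vle x y && vle x z;
  vleUx : forall x y z : V, vle (vjoin x y) z = vle x z && vle y z;
  vle_wD2r : forall z x y : V, vle x y -> vle (x + z) (y + z);
  vle_wZ2l : forall (a : R) (x y : V), 0 <= a -> vle x y -> vle (a *: x) (a *: y)
}.

#[short(type="vectLatticeType")]
HB.structure Definition VectLattice (R : realType) :=
  {V of Lmodule_isVectLattice R V & GRing.Lmodule R V}.

Section VectLatticeOrder.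
Context {R : realType} {V : vectLatticeType R}.

#[non_forgetful_inheritance]
HB.instance Definition _ := Order.Le_isPOrder.Build ring_display V
  (@vle_refl R V) (@vle_anti R V) (@vle_trans R V).
#[non_forgetful_inheritance]
HB.instance Definition _ := Order.POrder_isMeetSemilattice.Build ring_display V
  (@vlexI R V).
#[non_forgetful_inheritance]
HB.instance Definition _ := Order.POrder_isJoinSemilattice.Build ring_display V
  (@vleUx R V).

Fact lev_wD2r (z x y : V) : x <= y -> x + z <= y + z.
Proof. exact: vle_wD2r. Qed.

Fact lev_wZ2l (a : R) (x y : V) : 0 <= a -> x <= y -> a *: x <= a *: y.
Proof. exact: vle_wZ2l. Qed.

End VectLatticeOrder.

Section RealLine.
Context {R : realType}.

HB.instance Definition _ := Order.Total.copy R^o R.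

Fact regular_lev_wD2r (z x y : R^o) : x <= y -> x + z <= y + z.
Proof. by move=> xy; rewrite (lerD2r (z : R)). Qed.

Fact regular_lev_wZ2l (a : R) (x y : R^o) : 0 <= a -> x <= y -> a *: x <= a *: y.
Proof. by move=> a0 xy; exact: (ler_wpM2l a0 xy). Qed.

HB.instance Definition _ := @Lmodule_isVectLattice.Build R R^o
  <=%R Order.meet Order.join lexx le_anti le_trans lexI leUx
  regular_lev_wD2r regular_lev_wZ2l.

End RealLine.

Notation vprod V W := (V *prod[ring_display] W)%type.

Section Product.
Context {R : realType}.
Variables V W : vectLatticeType R.

HB.instance Definition _ := GRing.Lmodule.copy (vprod V W) (V * W)%type.

Fact vprod_lev_wD2r (z x y : vprod V W) : x <= y -> x + z <= y + z.
Proof. by case/andP=> xy1 xy2; apply/andP; split; exact: lev_wD2r. Qed.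

Fact vprod_lev_wZ2l (a : R) (x y : vprod V W) :
  0 <= a -> x <= y -> a *: x <= a *: y.
Proof. by move=> a0 /andP[xy1 xy2]; apply/andP; split; exact: lev_wZ2l. Qed.

HB.instance Definition _ := @Lmodule_isVectLattice.Build R (vprod V W)
  <=%R Order.meet Order.join lexx le_anti le_trans lexI leUx
  vprod_lev_wD2r vprod_lev_wZ2l.

End Product.

Section VectorLattices.
Context {R : realType} {V : vectLatticeType R}.
Implicit Types u v w : V.

Definition absv v : V := v `|` - v.

Definition weak_unit u := 0 <= u /\ forall v, u `&` v = 0 -> v = 0.

Definition strong_unit u :=
  0 <= u /\ forall v, 0 <= v -> exists n : nat, v <= u *+ n.

Definition polar v : set V := [set w | absv v `&` absv w = 0].

End VectorLattices.

Definition principal_polars (R : realType) (V : vectLatticeType R) :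
  set (set V) := range (@polar R V).
Arguments principal_polars {R} V.

Definition archimedean (R : realType) (V : vectLatticeType R) :=
  forall v w : V, 0 < v -> v <= w -> exists2 n : nat, (0 < n)%N & ~~ (v *+ n <= w).

Section Morphisms.
Context {R : realType} {V W : vectLatticeType R}.

Definition vlat_hom (f : V -> W) :=
  [/\ linear f, Order.meet_morphism f & Order.join_morphism f].

Definition unital_hom (u : V) (u' : W) (f : V -> W) := vlat_hom f /\ f u = u'.

End Morphisms.

(* Isomorphism in uVL, and in its full subcategory uHA. *)
Definition unital_iso (R : realType) (V W : vectLatticeType R) (u : V) (u' : W) :=
  exists (f : V -> W) (g : W -> V),
    [/\ unital_hom u u' f, unital_hom u' u g, cancel f g & cancel g f].

Definition hyperarchimedean (R : realType) (V : vectLatticeType R) :=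
  forall (W : vectLatticeType R) (f : V -> W),
    vlat_hom f -> set_surj [set: V] [set: W] f -> archimedean W.

(* (V, u) is an object of uHA. *)
Definition is_uHA (R : realType) (V : vectLatticeType R) (u : V) :=
  hyperarchimedean V /\ weak_unit u.

(* (V', u') is a direct factor of (V'', u''). *)
Definition direct_factor (R : realType) (V' V'' : vectLatticeType R)
    (u' : V') (u'' : V'') :=
  exists (V : vectLatticeType R) (u : V),
    [/\ strong_unit u, strong_unit u' & unital_iso u'' ((u, u') : vprod V V')].

Definition no_real_factor (R : realType) (V : vectLatticeType R) (u : V) :=
  ~ exists (V' : vectLatticeType R) (u' : V'),
      direct_factor u' u /\ unital_iso u' (1 : R^o).

Section LocallyConstant.
Variables (R : realType) (X : topologicalType).

Definition locally_constant (f : X -> R^o) :=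
  forall x, \forall y \near x, f y = f x.

Definition lc_pred : {pred X -> R^o} := [pred f | `[< locally_constant f >]].

Record LC := MkLC {
  LC_fun :> X -> R^o;
  LC_funP : LC_fun \in lc_pred
}.

HB.instance Definition _ := [isSub for LC_fun].
HB.instance Definition _ := [Choice of LC by <:].

Fact lc_submod_closed : submod_closed lc_pred.
Proof.
split=> [|a f g /asboolP lf /asboolP lg]; apply/asboolP => x.
  exact: nearW.
by near=> y; rewrite !fctE (near (lf x) y) // (near (lg x) y).
Unshelve. all: by end_near. Qed.

HB.instance Definition _ :=
  GRing.isSubmodClosed.Build R (X -> R^o) lc_pred lc_submod_closed.
HB.instance Definition _ := [SubChoice_isSubLmodule of LC by <:].

Fact lc_meet_closed : meet_closed lc_pred.
Proof.
move=> f g /asboolP lf /asboolP lg; apply/asboolP => x.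
by near=> y; rewrite !meetfE (near (lf x) y) // (near (lg x) y).
Unshelve. all: by end_near. Qed.

Fact lc_join_closed : join_closed lc_pred.
Proof.
move=> f g /asboolP lf /asboolP lg; apply/asboolP => x.
by near=> y; rewrite !joinfE (near (lf x) y) // (near (lg x) y).
Unshelve. all: by end_near. Qed.

HB.instance Definition _ := Order.SubChoice_isSubLattice.Build _ (X -> R^o) lc_pred
  ring_display LC lc_meet_closed lc_join_closed.

Fact LC_leP (f g : LC) : reflect (forall x, f x <= g x) (f <= g).
Proof. exact: lefP. Qed.

Fact LC_lev_wD2r (h f g : LC) : f <= g -> f + h <= g + h.
Proof. by move=> /LC_leP fg; apply/LC_leP => x; exact/lev_wD2r/fg. Qed.

Fact LC_lev_wZ2l (a : R) (f g : LC) : 0 <= a -> f <= g -> a *: f <= a *: g.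
Proof. by move=> a0 /LC_leP fg; apply/LC_leP => x; exact/lev_wZ2l/fg. Qed.

HB.instance Definition _ := @Lmodule_isVectLattice.Build R LC
  <=%R Order.meet Order.join lexx le_anti le_trans lexI leUx
  LC_lev_wD2r LC_lev_wZ2l.

Fact lc_pred_cst (a : R) : (cst a : X -> R^o) \in lc_pred.
Proof. by apply/asboolP => x; exact: nearW. Qed.

Definition LC1 : LC := MkLC (lc_pred_cst 1).

End LocallyConstant.

(* The product of copies of the discrete space {0,1} indexed by I; for I = nat
   this is cantor_space. *)
Definition cube (I : Type) : topologicalType := prod_topology (fun _ : I => bool).

(* The cardinal kappa is represented by an index type I of that cardinality. *)
Definition LC_free (R : realType) (I : Type) : vectLatticeType R := LC R (cube I).
Definition LC_free1 (R : realType) (I : Type) : LC_free R I := LC1 R (cube I).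

Definition aleph0_conditions (R : realType) (V : vectLatticeType R) (u : V) :=
  [/\ u != 0, no_real_factor u & countable (principal_polars V)].

(* Main.v *)
Require Import Defs.
From HB Require Import structures.
From mathcomp Require Import all_boot all_order all_algebra.
From mathcomp Require Import all_classical all_reals all_analysis.
From mathcomp Require Import generic_quotient.

(* In a hyperarchimedean V, quotienting by the ideal generated by all
   (t v - w)^+ shows that (w - t v)^+ is disjoint from v for some t. Hence every
   v >= 0 generates the same ideal as a component of the unit u (an e with
   e /\ (u - e) = 0), and modulo an ideal that decides all components V is the
   real line. Components embed in the principal polars, so there are countably
   many. If a component e were an atom, then V would be V/(e) x R; so there are
   no atoms, and one can build a binary tree of nonzero components that
   partitions u at each level and whose level n + 1 decides the n-th component.
   Each branch of the tree gives a unital lattice homomorphism from V to R, and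
   evaluation along the branches is the isomorphism of V with LC({0,1}^nat).
   Conversely, elements of LC({0,1}^nat) depend on finitely many coordinates,
   and flipping a further coordinate excludes a direct factor R. *)

Set Implicit Arguments.
Unset Strict Implicit.
Unset Printing Implicit Defensive.

Import Order.TTheory GRing.Theory Num.Theory.

Local Open Scope classical_set_scope.
Local Open Scope order_scope.
Local Open Scope ring_scope.

(** * Vector lattices *)

Section VectLatticeTheory.
Variables (R : realType) (V : vectLatticeType R).
Implicit Types (a b c x y z t u v w e : V) (r s : R).

Lemma lev_D2r z x y : (x + z <= y + z) = (x <= y).
Proof. by apply/idP/idP => [/(lev_wD2r (- z))|/lev_wD2r//]; rewrite !addrK. Qed.

Lemma lev_D2l z x y : (z + x <= z + y) = (x <= y).
Proof. by rewrite ![z + _]addrC lev_D2r. Qed.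

Lemma lev_D x y z t : x <= y -> z <= t -> x + z <= y + t.
Proof. by move=> xy zt; rewrite (le_trans (lev_wD2r z xy))// lev_D2l. Qed.

Lemma lev_BlDr x y z : (x - y <= z) = (x <= z + y).
Proof. by rewrite -(lev_D2r y (x - y)) subrK. Qed.

Lemma lev_BrDr x y z : (x <= y - z) = (x + z <= y).
Proof. by rewrite -(lev_D2r z x) subrK. Qed.

Lemma subv_ge0 x y : (0 <= y - x) = (x <= y).
Proof. by rewrite lev_BrDr add0r. Qed.

Lemma lev_N2 x y : (- x <= - y) = (y <= x).
Proof. by rewrite -(subv_ge0 (- x)) opprK addrC subv_ge0. Qed.

Lemma oppv_le0 x : (- x <= 0) = (0 <= x).
Proof. by rewrite -[in LHS]oppr0 lev_N2. Qed.

Lemma addv_ge0 x y : 0 <= x -> 0 <= y -> 0 <= x + y.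
Proof. by move=> x0 y0; rewrite -[0]addr0 lev_D. Qed.

Lemma lev_wDr x y z : 0 <= z -> x <= y -> x <= y + z.
Proof. by move=> z0 xy; rewrite -[x]addr0 lev_D. Qed.

Lemma lev_wDl x y z : 0 <= z -> x <= y -> x <= z + y.
Proof. by move=> z0 xy; rewrite addrC lev_wDr. Qed.

Lemma scalev_ge0 r x : 0 <= r -> 0 <= x -> 0 <= r *: x.
Proof. by move=> r0 x0; rewrite -(scaler0 _ r) lev_wZ2l. Qed.

Lemma lev_Z2l r x y : 0 < r -> (r *: x <= r *: y) = (x <= y).
Proof.
move=> r0; apply/idP/idP => [/(lev_wZ2l (ltW _)) h|/(lev_wZ2l (ltW r0))//].
have := h r^-1; rewrite invr_gt0 !scalerA mulVf ?gt_eqF// !scale1r; exact.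
Qed.

Lemma lev_wZ2r r s x : 0 <= x -> r <= s -> r *: x <= s *: x.
Proof. by move=> x0 rs; rewrite -subv_ge0 -scalerBl scalev_ge0// subr_ge0. Qed.

Lemma addvI z x y : (x `&` y) + z = (x + z) `&` (y + z).
Proof.
apply/eqP; rewrite eq_le lexI !lev_D2r leIl leIr /=.
by rewrite -lev_BlDr lexI !lev_BlDr leIl leIr.
Qed.

Lemma addvU z x y : (x `|` y) + z = (x + z) `|` (y + z).
Proof.
apply/eqP; rewrite eq_le leUx !lev_D2r leUl leUr andbT /=.
by rewrite -lev_BrDr leUx !lev_BrDr leUl leUr.
Qed.

Lemma lev_NlC x y : (- x <= y) = (- y <= x).
Proof. by rewrite -(lev_N2 y) opprK. Qed.

Lemma oppvI x y : - (x `&` y) = - x `|` - y.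
Proof.
apply/eqP; rewrite eq_le leUx !lev_N2 leIl leIr andbT lev_NlC lexI.
by rewrite !(lev_NlC (_ `|` _)) leUl leUr.
Qed.

Lemma oppvU x y : - (x `|` y) = - x `&` - y.
Proof. by rewrite -[RHS]opprK oppvI !opprK. Qed.

Lemma scalevI r x y : 0 <= r -> r *: (x `&` y) = (r *: x) `&` (r *: y).
Proof.
rewrite le_eqVlt => /predU1P[<-|r0]; first by rewrite !scale0r meetxx.
apply/eqP; rewrite eq_le lexI !lev_Z2l// leIl leIr /=.
have h z t : (z <= r *: t) = (r^-1 *: z <= t).
  by rewrite -(lev_Z2l _ t r0) scalerA divff ?gt_eqF// scale1r.
by rewrite h lexI -!h leIl leIr.
Qed.

Lemma scalevU r x y : 0 <= r -> r *: (x `|` y) = (r *: x) `|` (r *: y).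
Proof.
by move=> r0; rewrite -[RHS]opprK oppvU -!scalerN -scalevI// -oppvU !scalerN opprK.
Qed.

Lemma addvIU x y : (x `&` y) + (x `|` y) = x + y.
Proof.
apply/eqP; rewrite addrC eq_sym -subr_eq oppvI addrC addvU.
by rewrite addKr [x + y]addrC addKr joinC.
Qed.

(** The right side is the meet of the four sums a + a, c + a, a + b and c + b. Three of them have a
    summand a, and the fourth is b + c. *)
Lemma addvI_le a b c : 0 <= a -> 0 <= b -> 0 <= c ->
  a `&` (b + c) <= (a `&` b) + (a `&` c).
Proof.
move=> a0 b0 c0; rewrite addvI ![_ + (a `&` c)]addrC !addvI !lexI.
rewrite [c + b]addrC leIr !andbT.
by rewrite !leIxl//; do 1?[exact: lev_wDr | exact: lev_wDl].
Qed.

Lemma meetv_eq0_ge0l a b : a `&` b = 0 -> 0 <= a.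
Proof. by move=> <-; exact: leIl. Qed.

Lemma meetv_eq0_ge0r a b : a `&` b = 0 -> 0 <= b.
Proof. by move=> <-; exact: leIr. Qed.

Lemma meetv_eq0W a b c d : 0 <= c -> 0 <= d -> c <= a -> d <= b ->
  a `&` b = 0 -> c `&` d = 0.
Proof.
by move=> c0 d0 ca db ab; apply/le_anti; rewrite lexI c0 d0 -[X in _ <= X]ab leI2.
Qed.

Lemma meetvD_eq0 a b c : a `&` b = 0 -> a `&` c = 0 -> a `&` (b + c) = 0.
Proof.
move=> ab ac; have [a0 b0 c0] := And3 (meetv_eq0_ge0l ab) (meetv_eq0_ge0r ab)
  (meetv_eq0_ge0r ac).
apply/le_anti; rewrite lexI a0 addv_ge0// andbT.
by rewrite (le_trans (addvI_le _ _ _))// ab ac addr0.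
Qed.

(** With m = max(1, r), both a <= m a and r b <= m b, and scaling by m preserves disjointness. *)
Lemma meetvZ_eq0 r a b : 0 <= r -> a `&` b = 0 -> a `&` (r *: b) = 0.
Proof.
move=> r0 ab; have [a0 b0] := conj (meetv_eq0_ge0l ab) (meetv_eq0_ge0r ab).
have m0 : 0 <= Num.max 1 r by rewrite le_max ler01.
apply: (@meetv_eq0W (Num.max 1 r *: a) (Num.max 1 r *: b)) => //.
- exact: scalev_ge0.
- by rewrite -[X in X <= _]scale1r lev_wZ2r// le_max lexx.
- by rewrite lev_wZ2r// le_max lexx orbT.
- by rewrite -scalevI// ab scaler0.
Qed.

(** * Positive parts and absolute values *)

Definition posv x : V := x `|` 0.

Lemma posv_ge0 x : 0 <= posv x. Proof. exact: leUr. Qed.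

Lemma posv_ge x : x <= posv x. Proof. exact: leUl. Qed.

Lemma posv_id x : 0 <= x -> posv x = x.
Proof. by move=> x0; exact/join_idPl. Qed.

Lemma posv_eq0 x : (posv x == 0) = (x <= 0).
Proof. by rewrite /posv eq_joinr. Qed.

Lemma le_posv x y : x <= y -> posv x <= posv y.
Proof. by move=> xy; rewrite leU2. Qed.

Lemma posvZ r x : 0 <= r -> posv (r *: x) = r *: posv x.
Proof. by move=> r0; rewrite /posv scalevU// scaler0. Qed.

Lemma posvU x y : posv (x `|` y) = posv x `|` posv y.
Proof. by rewrite /posv joinACA joinxx. Qed.

Lemma posvN x : posv (- x) = posv x - x.
Proof. by rewrite /posv addvU subrr add0r joinC. Qed.

Lemma posvB x : x = posv x - posv (- x).
Proof. by rewrite posvN subKr. Qed.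

Lemma posvNI x : posv x `&` posv (- x) = 0.
Proof.
have -> : posv (- x) = - x + posv x by rewrite posvN addrC.
by rewrite -{1}[posv x]add0r -addvI -{1}oppr0 -oppvU joinC addNr.
Qed.

Lemma absv_ge0 x : 0 <= absv x.
Proof.
have : 0 <= 2 *: absv x.
  by rewrite scaler_nat mulr2n -(subrr x) lev_D ?leUl ?leUr.
by rewrite -[X in X <= _](scaler0 _ 2) lev_Z2l.
Qed.

Lemma absvN x : absv (- x) = absv x.
Proof. by rewrite /absv opprK joinC. Qed.

Lemma ge0_absv x : 0 <= x -> absv x = x.
Proof. by move=> x0; apply/join_idPl; rewrite (le_trans _ x0)// oppv_le0. Qed.

Lemma ler_absv x : x <= absv x. Proof. exact: leUl. Qed.

Lemma absv_le x y : (absv x <= y) = (x <= y) && (- x <= y).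
Proof. exact: leUx. Qed.

Lemma absv_triangle x y : absv (x + y) <= absv x + absv y.
Proof. by rewrite absv_le opprD !lev_D ?leUl ?leUr. Qed.

Lemma absvZ r x : absv (r *: x) = `|r| *: absv x.
Proof.
suff h s : 0 <= s -> absv (s *: x) = s *: absv x.
  case: (ger0P r) => [r0|/ltW r0]; first exact: h.
  by rewrite -absvN -scaleNr h// oppr_ge0.
by move=> s0; rewrite /absv scalevU// scalerN.
Qed.

Lemma absv_eq0 x : absv x = 0 -> x = 0.
Proof.
move=> x0; apply/le_anti; rewrite -x0 ler_absv x0 -oppv_le0 -x0 -absvN.
exact: ler_absv.
Qed.

Lemma posv_le_absv x : posv x <= absv x.
Proof. by rewrite leUx ler_absv absv_ge0. Qed.

Lemma posvD x y : posv (x + y) <= posv x + posv y.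
Proof. by rewrite leUx addv_ge0 ?posv_ge0// lev_D ?posv_ge. Qed.

Lemma absv_posvN x : absv (posv x) <= absv x.
Proof. by rewrite ge0_absv ?posv_ge0 ?posv_le_absv. Qed.

End VectLatticeTheory.

(** * Quotients by ideals *)

Section Ideals.
Local Open Scope quotient_scope.
Variables (R : realType) (V : vectLatticeType R).

Definition is_lideal (J : V -> Prop) :=
  [/\ J 0, forall x y, J x -> J y -> J (x + y),
      forall (r : R) x, J x -> J (r *: x) &
      forall x y, J y -> absv x <= absv y -> J x].

Record lideal := LIdeal { lideal_set :> V -> Prop; lidealP : is_lideal lideal_set }.

Variable J : lideal.
Implicit Types (x y z : V) (r s : R).

Lemma lideal0 : J 0. Proof. by case: (lidealP J). Qed.

Lemma lidealD x y : J x -> J y -> J (x + y).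
Proof. by case: (lidealP J) => _ + _ _; apply. Qed.

Lemma lidealZ r x : J x -> J (r *: x).
Proof. by case: (lidealP J) => _ _ + _; apply. Qed.

Lemma lidealN x : J x -> J (- x).
Proof. by rewrite -scaleN1r; exact: lidealZ. Qed.

Lemma lidealB x y : J x -> J y -> J (x - y).
Proof. by move=> Jx /lidealN; exact: lidealD. Qed.

Lemma lideal_abs x y : J y -> absv x <= absv y -> J x.
Proof. by case: (lidealP J) => _ _ _; apply. Qed.

Lemma lideal_le x y : J y -> 0 <= x -> x <= y -> J x.
Proof.
by move=> /lideal_abs Jy x0 xy; apply: Jy; rewrite !ge0_absv// (le_trans x0).
Qed.

Lemma lideal_posv x : J x -> J (posv x).
Proof. by move/lideal_abs; apply; exact: absv_posvN. Qed.

Definition lquot_rel (x y : V) := `[< J (x - y) >].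

Lemma lquot_rel_refl : reflexive lquot_rel.
Proof. by move=> x; apply/asboolP; rewrite subrr; exact: lideal0. Qed.

Lemma lquot_rel_sym : symmetric lquot_rel.
Proof.
by move=> x y; apply/asboolP/asboolP => /lidealN; rewrite opprB.
Qed.

Lemma lquot_rel_trans : transitive lquot_rel.
Proof.
move=> y x z /asboolP xy /asboolP yz; apply/asboolP.
by rewrite -(subrK y x) -addrA; exact: lidealD.
Qed.

Definition lquot_equiv :=
  EquivRel lquot_rel lquot_rel_refl lquot_rel_sym lquot_rel_trans.

Definition lquot := {eq_quot lquot_equiv}.

HB.instance Definition _ := Choice.on lquot.

Definition lpi (x : V) : lquot := \pi_({eq_quot lquot_equiv}) x.
Definition lrepr (a : lquot) : V := @repr _ {eq_quot lquot_equiv} a.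

Lemma lreprK a : lpi (lrepr a) = a.
Proof. exact: reprK. Qed.

Lemma lpi_eq x y : lpi x = lpi y <-> J (x - y).
Proof.
split; first by move=> /eqquotP/asboolP.
by move=> Jxy; apply/eqquotP/asboolP.
Qed.

Lemma lrepr_pi x : J (lrepr (lpi x) - x).
Proof. by apply/lpi_eq; exact: lreprK. Qed.

Lemma lquotW (P : lquot -> Prop) : (forall x, P (lpi x)) -> forall a, P a.
Proof. by move=> h a; rewrite -(lreprK a). Qed.

Definition lquot_add a b := lpi (lrepr a + lrepr b).
Definition lquot_opp a := lpi (- lrepr a).
Definition lquot_scale r a := lpi (r *: lrepr a).

Lemma lquot_add_pi x y : lquot_add (lpi x) (lpi y) = lpi (x + y).
Proof. by apply/lpi_eq; rewrite opprD addrACA; apply: lidealD; exact: lrepr_pi. Qed.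

Lemma lquot_opp_pi x : lquot_opp (lpi x) = lpi (- x).
Proof. by apply/lpi_eq; rewrite -opprD; apply: lidealN; exact: lrepr_pi. Qed.

Lemma lquot_scale_pi r x : lquot_scale r (lpi x) = lpi (r *: x).
Proof. by apply/lpi_eq; rewrite -scalerBr; apply: lidealZ; exact: lrepr_pi. Qed.

Lemma lquot_addA : associative lquot_add.
Proof.
by elim/lquotW => x; elim/lquotW => y; elim/lquotW => z; rewrite !lquot_add_pi addrA.
Qed.

Lemma lquot_addC : commutative lquot_add.
Proof. by elim/lquotW => x; elim/lquotW => y; rewrite !lquot_add_pi addrC. Qed.

Lemma lquot_add0 : left_id (lpi 0) lquot_add.
Proof. by elim/lquotW => x; rewrite !lquot_add_pi add0r. Qed.

Lemma lquot_addN : left_inverse (lpi 0) lquot_opp lquot_add.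
Proof. by elim/lquotW => x; rewrite lquot_opp_pi !lquot_add_pi addNr. Qed.

HB.instance Definition _ :=
  GRing.isZmodule.Build lquot lquot_addA lquot_addC lquot_add0 lquot_addN.

Lemma lpiD x y : lpi (x + y) = lpi x + lpi y.
Proof. by rewrite -lquot_add_pi. Qed.

Lemma lquot_scaleA r s a :
  lquot_scale r (lquot_scale s a) = lquot_scale (r * s) a.
Proof. by elim/lquotW: a => x; rewrite !lquot_scale_pi scalerA. Qed.

Lemma lquot_scale1 : left_id 1 lquot_scale.
Proof. by elim/lquotW => x; rewrite !lquot_scale_pi scale1r. Qed.

Lemma lquot_scaleDr : right_distributive lquot_scale +%R.
Proof.
move=> r; elim/lquotW => x; elim/lquotW => y.
by rewrite -lpiD !lquot_scale_pi scalerDr lpiD.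
Qed.

Lemma lquot_scaleDl a : {morph lquot_scale^~ a : r s / r + s}.
Proof. by move=> r s; elim/lquotW: a => x; rewrite !lquot_scale_pi scalerDl lpiD. Qed.

HB.instance Definition _ := GRing.Zmodule_isLmodule.Build R lquot
  lquot_scaleA lquot_scale1 lquot_scaleDr lquot_scaleDl.

Lemma lpi_is_linear : linear lpi.
Proof. by move=> r x y; rewrite lpiD; congr (_ + _); rewrite -lquot_scale_pi. Qed.

HB.instance Definition _ :=
  GRing.isLinear.Build R V lquot _ lpi lpi_is_linear.

(** The class of x lies below that of y when (x - y)^+ is in J. The choice of representatives is
    harmless by [lquot_le_pi]. *)
Definition lquot_le (a b : lquot) : bool := `[< J (posv (lrepr a - lrepr b)) >].
Definition lquot_meet a b := lpi (lrepr a `&` lrepr b).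
Definition lquot_join a b := lpi (lrepr a `|` lrepr b).

Lemma lideal_posv_mod x y : J (x - y) -> J (posv x) -> J (posv y).
Proof.
move=> /lidealN/lideal_posv; rewrite opprB => Jxy Jx.
apply: (lideal_le (lidealD Jxy Jx)); rewrite ?posv_ge0//.
by rewrite -{1}(subrK x y) posvD.
Qed.

Lemma lquot_le_pi x y : lquot_le (lpi x) (lpi y) <-> J (posv (x - y)).
Proof.
have Jd : J ((lrepr (lpi x) - lrepr (lpi y)) - (x - y)).
  rewrite opprD opprK addrACA [- _ + y]addrC -[y - _]opprB.
  by apply: lidealB; exact: lrepr_pi.
split=> [/asboolP|Jxy]; first exact: lideal_posv_mod.
apply/asboolP; move: Jxy; apply: lideal_posv_mod.
by rewrite -opprB; exact: lidealN.
Qed.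

Lemma lidealU x y : 0 <= x -> 0 <= y -> J (x `|` y) <-> J x /\ J y.
Proof.
move=> x0 y0; split=> [Jxy|[Jx Jy]].
  by split; apply: (lideal_le Jxy); rewrite ?leUl ?leUr.
apply: (lideal_le (lidealD Jx Jy)); rewrite ?lexUl// leUx.
by rewrite lev_wDr// lev_wDl.
Qed.

Lemma lquot_le_refl : reflexive lquot_le.
Proof.
elim/lquotW => x; apply/lquot_le_pi; rewrite subrr /posv joinxx.
exact: lideal0.
Qed.

Lemma lquot_le_anti : antisymmetric lquot_le.
Proof.
elim/lquotW => x; elim/lquotW => y /andP[/lquot_le_pi xy /lquot_le_pi yx].
by apply/lpi_eq; rewrite [x - y]posvB opprB; exact: lidealB.
Qed.

Lemma lquot_le_trans : transitive lquot_le.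
Proof.
elim/lquotW => y; elim/lquotW => x; elim/lquotW => z /lquot_le_pi xy /lquot_le_pi yz.
apply/lquot_le_pi; apply: (lideal_le (lidealD xy yz)); first exact: posv_ge0.
by rewrite -{1}(subrK y x) -addrA posvD.
Qed.

Lemma lquot_le_piI x y z :
  lquot_le (lpi x) (lpi (y `&` z)) = lquot_le (lpi x) (lpi y) && lquot_le (lpi x) (lpi z).
Proof.
have E : posv (x - y `&` z) = posv (x - y) `|` posv (x - z).
  by rewrite oppvI addrC addvU posvU ![_ + x]addrC.
apply/idP/andP.
  move/lquot_le_pi; rewrite E => /lidealU[]; rewrite ?posv_ge0// => xy xz.
  by split; exact/lquot_le_pi.
move=> [/lquot_le_pi xy /lquot_le_pi xz]; apply/lquot_le_pi; rewrite E.
by apply/lidealU => //; exact: posv_ge0.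
Qed.

Lemma lquot_le_piU x y z :
  lquot_le (lpi (x `|` y)) (lpi z) = lquot_le (lpi x) (lpi z) && lquot_le (lpi y) (lpi z).
Proof.
have E : posv ((x `|` y) - z) = posv (x - z) `|` posv (y - z).
  by rewrite addvU posvU.
apply/idP/andP.
  move/lquot_le_pi; rewrite E => /lidealU[]; rewrite ?posv_ge0// => xy xz.
  by split; exact/lquot_le_pi.
move=> [/lquot_le_pi xy /lquot_le_pi xz]; apply/lquot_le_pi; rewrite E.
by apply/lidealU => //; exact: posv_ge0.
Qed.

Lemma lquot_lexI a b c : lquot_le a (lquot_meet b c) = lquot_le a b && lquot_le a c.
Proof. by rewrite -{1 2 3}(lreprK a) lquot_le_piI !lreprK. Qed.

Lemma lquot_leUx a b c : lquot_le (lquot_join a b) c = lquot_le a c && lquot_le b c.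
Proof. by rewrite -{1 2 3}(lreprK c) lquot_le_piU !lreprK. Qed.

Lemma lquot_le_D2r c a b : lquot_le a b -> lquot_le (a + c) (b + c).
Proof.
elim/lquotW: a => x; elim/lquotW: b => y; elim/lquotW: c => z /lquot_le_pi xy.
by rewrite -!lpiD; apply/lquot_le_pi; rewrite opprD addrACA subrr addr0.
Qed.

Lemma lquot_le_Z2l r a b : 0 <= r -> lquot_le a b -> lquot_le (r *: a) (r *: b).
Proof.
move=> r0; elim/lquotW: a => x; elim/lquotW: b => y /lquot_le_pi xy.
rewrite -!linearZ; apply/lquot_le_pi; rewrite -scalerBr posvZ//.
exact: lidealZ.
Qed.

HB.instance Definition _ := @Lmodule_isVectLattice.Build R lquot
  lquot_le lquot_meet lquot_join lquot_le_refl lquot_le_anti lquot_le_trans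
  lquot_lexI lquot_leUx lquot_le_D2r lquot_le_Z2l.

Definition lquotient : vectLatticeType R := lquot.

Definition lproj x : lquotient := lpi x.

Lemma lproj_le x y : lproj x <= lproj y <-> J (posv (x - y)).
Proof. exact: lquot_le_pi. Qed.

Lemma lproj_eq0 x : lproj x = 0 <-> J x.
Proof. by rewrite -[X in J X]subr0 -lpi_eq. Qed.

Lemma lproj_ge0 x : 0 <= lproj x <-> J (posv (- x)).
Proof. by rewrite -[X in posv X]sub0r -lproj_le. Qed.

Lemma lproj_wge0 x : 0 <= x -> 0 <= lproj x.
Proof.
rewrite -oppv_le0 -posv_eq0 => /eqP x0; apply/lproj_ge0; rewrite x0.
exact: lideal0.
Qed.

Lemma lproj_vlat_hom : vlat_hom lproj.
Proof.
split; first exact: lpi_is_linear.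
(* Two elements with the same lower bounds are equal; joins are treated dually. *)
- move=> x y; have E a : (a <= lproj (x `&` y)) = (a <= lproj x `&` lproj y).
    by rewrite lexI; elim/lquotW: a => z; exact: lquot_le_piI.
  by apply/le_anti; rewrite -E lexx E lexx.
- move=> x y; have E a : (lproj (x `|` y) <= a) = (lproj x `|` lproj y <= a).
    by rewrite leUx; elim/lquotW: a => z; exact: lquot_le_piU.
  by apply/le_anti; rewrite E lexx -E lexx.
Qed.

Lemma lproj_surj : set_surj [set: V] [set: lquotient] lproj.
Proof. by move=> a _; exists (lrepr a) => //; exact: lreprK. Qed.

End Ideals.

(** * Hyperarchimedean vector lattices *)

Section LinearMaps.
Variables (R : realType) (V W : vectLatticeType R) (f : V -> W).
Hypothesis lf : linear f.

Lemma linvD x y : f (x + y) = f x + f y.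
Proof. by have := lf 1 x y; rewrite !scale1r. Qed.

Lemma linv0 : f 0 = 0.
Proof. by apply: (@addrI _ (f 0)); rewrite -linvD !addr0. Qed.

Lemma linvZ (r : R) x : f (r *: x) = r *: f x.
Proof. by have := lf r x 0; rewrite !addr0 linv0 addr0. Qed.

Lemma linvN x : f (- x) = - f x.
Proof. by rewrite -scaleN1r linvZ scaleN1r. Qed.

Lemma linvB x y : f (x - y) = f x - f y.
Proof. by rewrite linvD linvN. Qed.

End LinearMaps.

(** * Generated ideals and the Archimedean property *)

Section Generated.
Variables (R : realType) (V : vectLatticeType R).
Implicit Types (x y z v w u e b : V) (r s t : R) (I : lideal V).

(** This is the ideal generated by all [g t] with t >= 0: since g is increasing, one t can serve
    both as index and as factor. A constant g gives a principal ideal. *)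
Lemma is_lideal_family (g : R -> V) : (forall t, 0 <= g t) ->
    {homo g : s t / s <= t} ->
  is_lideal (fun z => exists2 t, 0 <= t & absv z <= t *: g t).
Proof.
move=> g0 gm.
have mono s t : 0 <= s -> s <= t -> s *: g s <= t *: g t.
  move=> s0 st; apply: (@le_trans _ _ (s *: g t)); first exact/lev_wZ2l/gm.
  exact: lev_wZ2r.
split.
- by exists 0 => //; rewrite scale0r ge0_absv.
- move=> x y [s s0 xs] [t t0 yt]; exists (s + t); first exact: addr_ge0.
  rewrite (le_trans (absv_triangle _ _))// scalerDl lev_D//.
    by rewrite (le_trans xs)// lev_wZ2l// gm// lerDl.
  by rewrite (le_trans yt)// lev_wZ2l// gm// lerDr.
(* The extra 1 keeps the new index above t even when |r| < 1, so that monotonicity of g applies. *)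
- move=> r x [t t0 xt]; exists ((`|r| + 1) * t); first by rewrite mulr_ge0// addr_ge0.
  rewrite absvZ (le_trans (lev_wZ2l _ xt))// scalerA.
  have tt : t <= (`|r| + 1) * t by rewrite ler_peMl// lerDr.
  apply: (@le_trans _ _ ((`|r| + 1) * t *: g t)).
    by rewrite lev_wZ2r// ler_wpM2r// lerDl.
  by rewrite lev_wZ2l ?gm// mulr_ge0// addr_ge0.
- by move=> x y [t t0 yt] xy; exists t => //; exact: le_trans xy yt.
Qed.

(** Modulo the ideal J generated by the (t v - w)^+, all n v stay below w, so v is in J because V/J
    is Archimedean. Hence v <= t (t v - w)^+ for some t, and the right side is disjoint from (w - t
    v)^+. *)
Lemma hyperarchimedean_disjoint v w : hyperarchimedean V -> 0 <= v -> 0 <= w ->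
  exists2 t, 0 <= t & posv (w - t *: v) `&` v = 0.
Proof.
move=> hV v0 w0; pose g t := posv (t *: v - w).
have g0 t : 0 <= g t by exact: posv_ge0.
have gm : {homo g : s t / s <= t}.
  by move=> s t st; rewrite le_posv// lev_D2r lev_wZ2r.
pose J := LIdeal (is_lideal_family g0 gm).
have Jg t : 1 <= t -> J (g t).
  move=> t1; exists t; first exact: le_trans t1.
  by rewrite ge0_absv// -[X in X <= _]scale1r lev_wZ2r.
have [lp _ _] := lproj_vlat_hom J.
have Jv : J v.
  apply: contrapT => nJv.
  have v1 : 0 < lproj J v.
    rewrite lt_def; apply/andP; split; first by apply/eqP => /lproj_eq0.
    exact: lproj_wge0.
  have vw : lproj J v <= lproj J w.
    by apply/lproj_le; have := Jg 1 (lexx _); rewrite /g scale1r.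
  have [n n0 /negP] := hV _ _ (lproj_vlat_hom J) (@lproj_surj _ _ J) _ _ v1 vw; apply.
  rewrite -scaler_nat -(linvZ lp); apply/lproj_le.
  by apply: Jg; rewrite ler1n.
have [t t0 vt] := Jv; exists t => //.
have : posv (w - t *: v) `&` (t *: g t) = 0.
  by apply: meetvZ_eq0 => //; rewrite /g -[w - _]opprB meetC posvNI.
apply: meetv_eq0W => //; first exact: posv_ge0.
by rewrite -(ge0_absv v0).
Qed.

Lemma scalev_le_inv u r s : 0 < u -> r *: u <= s *: u -> r <= s.
Proof.
move=> u0 ru; rewrite leNgt; apply/negP => sr.
have : (r - s) *: u <= (r - s) *: 0 by rewrite scaler0 scalerBl lev_BlDr add0r.
by rewrite lev_Z2l ?subr_gt0// => /le_gtF; rewrite u0.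
Qed.

(** The hypotheses say that every nonzero positive element generates V as an ideal. Then V is
    totally ordered, and the coefficient of v is the supremum of the r with r u <= v. *)
Lemma multiples_of_unit u : 0 < u ->
    (forall v, exists2 t, 0 <= t & v <= t *: u) ->
    (forall v, 0 <= v -> v = 0 \/ exists2 t, 0 <= t & u <= t *: v) ->
  forall v, exists r, v = r *: u.
Proof.
move=> u0 bounded dense v.
(* If w^+ is nonzero, it dominates a multiple of u, so w^- is disjoint from u. As w^- is below some
   s u, it is disjoint from itself. *)
have total w : w <= 0 \/ 0 <= w.
  have [/eqP|[t t0 ut]] := dense _ (posv_ge0 w); first by rewrite posv_eq0; left.
  right; have [s s0 ws] := bounded (posv (- w)).
  have wu : posv (- w) `&` (s *: u) = 0.
    apply: meetvZ_eq0 => //; have := meetvZ_eq0 t0 (posvNI (- w)); rewrite opprK.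
    by apply: meetv_eq0W; rewrite ?posv_ge0// ltW.
  by rewrite -oppv_le0 -posv_eq0 -wu; apply/eqP/esym/meet_idPl.
pose S := [set r | r *: u <= v]; pose r := sup S; exists r.
have hS : has_sup S.
  split.
    have [t t0 vt] := bounded (- v); exists (- t).
    by rewrite /S /= scaleNr lev_NlC.
  have [t t0 vt] := bounded v; exists t => s sv.
  by apply: (scalev_le_inv u0); exact: le_trans sv vt.
apply/eqP; rewrite -subr_eq0; apply/eqP/absv_eq0.
have [//|[t t0 ut]] := dense _ (absv_ge0 (v - r *: u)).
have {}t0 : 0 < t.
  rewrite lt_def t0 andbT; apply/negP => /eqP t_0.
  by move: ut; rewrite t_0 scale0r => /le_gtF; rewrite u0.
(* The supremum gives |v - r u| <= e u for every e > 0. This e has t e = 1/2, which contradicts u <=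
   t |v - r u|. *)
pose e := (t *+ 2)^-1.
have e0 : 0 < e by rewrite invr_gt0 mulrn_wgt0.
have : u <= (t * e) *: u.
  rewrite (le_trans ut)// -scalerA lev_Z2l// absv_le; apply/andP; split.
    rewrite lev_BlDr -scalerDl; have [|ve] := total (v - (e + r) *: u).
      by rewrite lev_BlDr add0r.
    have : e + r <= r by apply: ub_le_sup; [case: hS | rewrite /S /= -subv_ge0].
    by rewrite gerDr leNgt e0.
  have [s sv rs] := sup_adherent e0 hS.
  rewrite opprB lev_BlDr addrC -lev_BlDr -scalerBl.
  by apply: le_trans sv; rewrite lev_wZ2r ?ltW.
rewrite -[X in X <= _]scale1r => /(scalev_le_inv u0).
rewrite /e -mulr_natr invfM mulrA divff ?gt_eqF// mul1r invf_ge1//.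
by rewrite lern1.
Qed.

End Generated.

(** * Components and real characters *)

Section Components.
Variables (R : realType) (V : vectLatticeType R) (u : V).
Hypothesis Hu : is_uHA u.
Implicit Types (x y z v w e b : V) (r s t : R) (I : lideal V).

Let u_ge0 : 0 <= u. Proof. by case: Hu => _ []. Qed.

(** For some t, (v^+ - t u)^+ is disjoint from the weak unit u, so it vanishes. *)
Lemma uHA_bounded v : exists2 t, 0 <= t & v <= t *: u.
Proof.
have [hV [_ wu]] := Hu.
have [t t0 vt] := hyperarchimedean_disjoint hV u_ge0 (posv_ge0 v).
exists t => //; apply: (le_trans (posv_ge v)).
rewrite -subv_ge0 -oppv_le0 opprB -posv_eq0; apply/eqP/wu.
by rewrite meetC.
Qed.

Definition component e := e `&` (u - e) = 0.

(** The component is b = u /\ t w. It lies below t w, while u - b is disjoint from w, hence also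
    from t w and from b. *)
Lemma component_support w : 0 <= w -> exists t, [/\ 0 <= t,
  component (u - posv (u - t *: w)) & posv (u - t *: w) `&` w = 0].
Proof.
move=> w0; have [hV _] := Hu.
have [t t0 wt] := hyperarchimedean_disjoint hV w0 u_ge0.
exists t; split=> //; rewrite /component subKr meetC.
apply: meetv_eq0W (meetvZ_eq0 t0 wt) => //; first exact: posv_ge0.
  by rewrite subv_ge0 leUx u_ge0 andbT lev_BlDr lev_wDr// scalev_ge0.
by rewrite lev_BlDr addrC -lev_BlDr posv_ge.
Qed.

Lemma lideal_coef_uniq I v r s : ~ I u -> I (v - r *: u) -> I (v - s *: u) -> r = s.
Proof.
move=> nIu Ir Is; apply: contrapT => /eqP; rewrite -subr_eq0 => rs; apply: nIu.
have := lidealZ (r - s)^-1 (lidealB Is Ir).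
by rewrite opprB [v - _ + _]addrC addrA subrK -scalerBl scalerA mulVf// scale1r.
Qed.

(** The quotient V/I satisfies the hypotheses of [multiples_of_unit], and [phi v] is the coefficient
    of the class of v. *)
Lemma character_of_lideal I : ~ I u ->
    (forall b, component b -> I b \/ I (u - b)) ->
  exists phi : V -> R^o, [/\ linear phi, forall v, 0 <= v -> 0 <= phi v,
    phi u = 1 & forall v, I (v - phi v *: u)].
Proof.
move=> nIu dich; have [lp _ _] := lproj_vlat_hom I.
have U0 : 0 < lproj I u.
  by rewrite lt_def lproj_wge0// andbT; apply/eqP => /lproj_eq0.
have bounded (a : lquotient I) : exists2 t, 0 <= t & a <= t *: lproj I u.
  have [v _ <-] := lproj_surj (J := I) (Logic.I : setT a).
  have [t t0 vt] := uHA_bounded v; exists t => //.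
  by rewrite -(linvZ lp) -subv_ge0 -(linvB lp) lproj_wge0// subv_ge0.
have dense (a : lquotient I) : 0 <= a -> a = 0 \/ exists2 t, 0 <= t & lproj I u <= t *: a.
  have [v _ <-] := lproj_surj (J := I) (Logic.I : setT a) => /lproj_ge0 v0.
  have -> : lproj I v = lproj I (posv v).
    apply/eqP; rewrite -subr_eq0 -(linvB lp); apply/eqP/lproj_eq0.
    by rewrite -opprB -posvN; exact: lidealN.
  have [t [t0 cb bv]] := component_support (posv_ge0 v).
  (* Let b be the support of v^+. If u - b is in I, then u <= t v^+ modulo I. If b is in I, then so
     is v^+: cutting v^+ <= s u along b and u - b leaves v^+ <= s b. *)
  have [Ib|] := dich _ cb; last first.
    by rewrite subKr => Ib; right; exists t => //; rewrite -(linvZ lp); apply/lproj_le.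
  left; apply/lproj_eq0; have [s s0 vs] := uHA_bounded (posv v).
  apply: (lideal_le (lidealZ s Ib)); first exact: posv_ge0.
  have E : posv v `&` (s *: (u - posv (u - t *: posv v)) +
      s *: posv (u - t *: posv v)) = posv v.
    by rewrite -scalerDr subrK; apply/meet_idPl.
  rewrite -[X in X <= _]E.
  apply: (le_trans (addvI_le _ _ _)); rewrite ?posv_ge0 ?scalev_ge0 ?posv_ge0//.
    exact: meetv_eq0_ge0l cb.
  have -> : posv v `&` (s *: posv (u - t *: posv v)) = 0.
    by apply: meetvZ_eq0 => //; rewrite meetC.
  by rewrite addr0 leIr.
have mult := multiples_of_unit U0 bounded dense.
have ex v : exists r, I (v - r *: u).
  have [r vr] := mult (lproj I v); exists r; apply/lproj_eq0.
  by rewrite (linvB lp) (linvZ lp) vr subrr.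
pose phi v : R^o := sval (cid (ex v)).
have phiP v : I (v - phi v *: u) by rewrite /phi; case: cid.
exists phi; split=> //.
- move=> r v w; apply: (lideal_coef_uniq nIu (phiP _)).
  rewrite scalerDl -scalerA opprD addrACA -scalerBr.
  by apply: lidealD; [apply: lidealZ|]; exact: phiP.
- move=> v v0; apply: (scalev_le_inv U0); rewrite scale0r -(linvZ lp).
  have -> : lproj I (phi v *: u) = lproj I v; last exact: lproj_wge0.
  by apply/eqP; rewrite eq_sym -subr_eq0 -(linvB lp); apply/eqP/lproj_eq0.
- by apply: (lideal_coef_uniq nIu (phiP _)); rewrite scale1r subrr; exact: lideal0.
Qed.

End Components.

(** * Components of the unit *)

Section Isomorphisms.
Variables (R : realType) (V W : vectLatticeType R) (u : V) (u' : W) (f : V -> W).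

(** By linearity, preserving and reflecting positivity makes f an order embedding, hence injective;
    a surjective one preserves meets and joins. *)
Lemma unital_iso_of_order_iso : linear f -> (forall a, exists v, f v = a) ->
  (forall v, 0 <= v <-> 0 <= f v) -> f u = u' -> unital_iso u u'.
Proof.
move=> lf surj pos fu.
have fle x y : (f x <= f y) = (x <= y).
  rewrite -subv_ge0 -(linvB lf) -[RHS]subv_ge0.
  by apply/idP/idP => /pos.
have inj : injective f by move=> x y fxy; apply/le_anti; rewrite -!fle fxy lexx.
pose g a := sval (cid (surj a)).
have fg : cancel g f by move=> a; rewrite /g; case: cid.
have gf : cancel f g by move=> v; apply: inj; rewrite fg.
have fI : Order.meet_morphism f.
  move=> x y; apply/le_anti; rewrite lexI !fle leIl leIr /=.
  by rewrite -[f x `&` f y]fg fle lexI -!fle fg leIl leIr.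
have fU : Order.join_morphism f.
  move=> x y; apply/le_anti; rewrite leUx !fle leUl leUr andbT.
  by rewrite -[f x `|` f y]fg fle leUx -!fle fg leUl leUr.
exists f, g; split=> //; split=> //; last by apply: inj; rewrite fg.
split.
- by move=> r a b; apply: inj; rewrite lf !fg.
- by move=> a b; apply: inj; rewrite fI !fg.
- by move=> a b; apply: inj; rewrite fU !fg.
Qed.

End Isomorphisms.

Section ComponentAlgebra.
Variables (R : realType) (V : vectLatticeType R) (u : V).
Implicit Types (x y z v w e b : V) (r s t : R) (I : lideal V).

Lemma component_ge0 e : component u e -> 0 <= e.
Proof. exact: meetv_eq0_ge0l. Qed.

Lemma component_le e : component u e -> e <= u.
Proof. by move/meetv_eq0_ge0r; rewrite subv_ge0. Qed.

Lemma componentC e : component u e -> component u (u - e).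
Proof. by rewrite /component subKr meetC. Qed.

Lemma component0 : 0 <= u -> component u 0.
Proof. by move=> u0; rewrite /component subr0; apply/meet_idPl. Qed.

Lemma componentT : 0 <= u -> component u u.
Proof. by move=> u0; rewrite /component subrr; apply/meet_idPr. Qed.

(** The complement of e /\ b is (u - e) \/ (u - b), which lies below the sum of two elements
    disjoint from e /\ b. *)
Lemma componentI e b : component u e -> component u b -> component u (e `&` b).
Proof.
move=> ce cb; have [e0 b0] := conj (component_ge0 ce) (component_ge0 cb).
have eb0 : 0 <= e `&` b by rewrite lexI e0.
have h : (e `&` b) `&` ((u - e) + (u - b)) = 0.
  apply: meetvD_eq0.
    by apply: (meetv_eq0W _ _ _ _ ce); rewrite ?leIl ?lexx ?subv_ge0 ?component_le.
  by apply: (meetv_eq0W _ _ _ _ cb); rewrite ?leIr ?lexx ?subv_ge0 ?component_le.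
apply: meetv_eq0W h => //.
  by rewrite subv_ge0 leIxl// component_le.
have -> : u - e `&` b = (u - e) `|` (u - b).
  by rewrite oppvI addrC addvU ![_ + u]addrC.
rewrite leUx; apply/andP; split; [apply: lev_wDr | apply: lev_wDl] => //;
  by rewrite subv_ge0 component_le.
Qed.

Lemma component_disjoint e b : component u e -> component u b ->
  (e `&` b) `&` (e `&` (u - b)) = 0.
Proof.
move=> ce cb; have [e0 b0] := conj (component_ge0 ce) (component_ge0 cb).
by apply: (meetv_eq0W _ _ _ _ cb); rewrite ?leIr// lexI e0 //= subv_ge0 component_le.
Qed.

Lemma component_split e b : component u e -> component u b ->
  (e `&` b) + (e `&` (u - b)) = e.
Proof.
move=> ce cb; have [e0 b0] := conj (component_ge0 ce) (component_ge0 cb).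
apply/le_anti/andP; split.
  by rewrite -addvIU component_disjoint// add0r leUx !leIl.
have {1}-> : e = e `&` (b + (u - b)).
  by rewrite addrC subrK; apply/esym/meet_idPl/component_le.
by apply: addvI_le => //; rewrite subv_ge0 component_le.
Qed.

(** The element u - e is in the polar of e. If it is in the polar of b as well, then b = b /\ e. *)
Lemma polar_component_inj e b : component u e -> component u b ->
  polar e = polar b -> e = b.
Proof.
suff le e' b' : component u e' -> component u b' -> polar e' = polar b' -> b' <= e'.
  by move=> ce cb eb; apply/le_anti; rewrite !le.
move=> ce cb eb; have : polar b' (u - e').
  by rewrite -eb /polar /= !ge0_absv ?(component_ge0 ce, component_ge0 (componentC ce)).
rewrite /polar /= !ge0_absv ?(component_ge0 cb, component_ge0 (componentC ce))// => d.
by rewrite -(component_split cb ce) d addr0 leIr.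
Qed.

Lemma component_enum : 0 <= u -> countable (principal_polars V) ->
  exists b : nat -> V, (forall n, component u (b n)) /\
    forall e, component u e -> exists n, b n = e.
Proof.
move=> u0 /countable_injP[f finj].
(* The default 0 is itself a component, so [b n] is one even if n encodes no polar of a
   component. *)
pose b n := xget 0 [set e | component u e /\ f (polar e) = n].
have bP n : component u (b n).
  by rewrite /b; case: xgetP => [e _ []//|_]; exact: component0.
exists b; split=> // e ce; exists (f (polar e)).
rewrite /b; case: xgetP => [e' _ [ce' fe]|/(_ e)]; last by case.
apply: polar_component_inj => //; apply: finj fe; apply/mem_set;
  by eexists.
Qed.

(** This is the increasing union of the polars of the [d n]. A constant d gives a single polar; a
    branch of a tree of components will give the ideal of a point. *)
Lemma is_lideal_disjoint (d : nat -> V) : (forall n, 0 <= d n) ->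
    {homo d : m n / (m <= n)%N >-> n <= m} ->
  is_lideal (fun z => exists n, d n `&` absv z = 0).
Proof.
move=> d0 dm; have mono m n z : (m <= n)%N -> d m `&` absv z = 0 -> d n `&` absv z = 0.
  move=> mn; apply: meetv_eq0W => //; [exact: absv_ge0 | exact: dm].
split.
- by exists 0%N; rewrite ge0_absv//; apply/meet_idPr.
- move=> x y [m xm] [n yn]; exists (maxn m n).
  have h : d (maxn m n) `&` (absv x + absv y) = 0.
    apply: meetvD_eq0; first by apply: mono xm; exact: leq_maxl.
    by apply: mono yn; exact: leq_maxr.
  by apply: meetv_eq0W h => //; [exact: absv_ge0 | exact: absv_triangle].
- by move=> r x [n xn]; exists n; rewrite absvZ meetvZ_eq0.
- move=> x y [n yn] xy; exists n; apply: meetv_eq0W yn => //.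
  exact: absv_ge0.
Qed.

End ComponentAlgebra.

Section Atomless.
Variables (R : realType) (V : vectLatticeType R) (u : V).
Hypothesis Hu : is_uHA u.
Implicit Types (x y z v w e b : V) (r s t : R) (I : lideal V).

Let u_ge0 : 0 <= u. Proof. by case: Hu => _ []. Qed.

Lemma strong_unitP (W : vectLatticeType R) (w : W) : 0 <= w ->
  (forall v : W, exists2 t : R, 0 <= t & v <= t *: w) -> strong_unit w.
Proof.
move=> w0 bounded; split=> // v _; have [t t0 vt] := bounded v.
exists (Num.bound t); rewrite -scaler_nat (le_trans vt)// lev_wZ2r// ltW//.
exact: archi_boundP.
Qed.

(** If no component cuts e, then the polar I of e decides all components and yields a character phi.
    With J the ideal generated by e, the map from v to (v mod J, phi v) is an isomorphism of V with
    V/J x R. *)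
Lemma atomless : no_real_factor u -> forall e, component u e -> e != 0 ->
  exists b, [/\ component u b, e `&` b != 0 & e `&` (u - b) != 0].
Proof.
move=> nreal e ce en0; apply: contrapT => noB; apply: nreal.
have e0 := component_ge0 ce.
have hI : is_lideal (fun z => exists n : nat, e `&` absv z = 0).
  exact: (@is_lideal_disjoint _ _ (fun=> e)).
pose I := LIdeal hI.
have hJ : is_lideal (fun z : V => exists2 t : R, 0 <= t & absv z <= t *: e).
  exact: (@is_lideal_family _ _ (fun=> e)).
pose J := LIdeal hJ.
have IJ z : 0 <= z -> I z -> J z -> z = 0.
  move=> z0 [_ ez] [t t0]; rewrite ge0_absv// in ez * => zt.
  have <- : z `&` (t *: e) = 0 by apply: meetvZ_eq0 => //; rewrite meetC.
  by apply/esym/meet_idPl.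
have nIu : ~ I u.
  move=> [_]; rewrite ge0_absv// => eu; move: en0.
  by rewrite -eu; apply/negP; rewrite negbK; apply/eqP/esym/meet_idPl/component_le.
have dich b : component u b -> I b \/ I (u - b).
  move=> cb; apply: contrapT => nb; apply: noB; exists b; split=> //.
    apply/eqP => eb; apply: nb; left; exists 0%N.
    by rewrite ge0_absv// (component_ge0 cb).
  apply/eqP => eb; apply: nb; right; exists 0%N.
  by rewrite ge0_absv// (component_ge0 (componentC cb)).
have [phi [lphi phi_ge0 phiu phiP]] := character_of_lideal Hu nIu dich.
have [lp _ _] := lproj_vlat_hom J.
have phie : phi e = 1.
  apply: (lideal_coef_uniq nIu (phiP _)); rewrite scale1r -opprB.
  apply: lidealN; exists 0%N; rewrite ge0_absv//.
  exact: component_ge0 (componentC ce).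
have pie : lproj J e = 0.
  by apply/lproj_eq0; exists 1 => //; rewrite ge0_absv// scale1r.
exists R^o, (1 : R^o); split; last first.
  by apply: (@unital_iso_of_order_iso _ _ _ _ _ id) => // a; exists a.
exists (lquotient J), (lproj J u); split.
- apply: strong_unitP; first exact: lproj_wge0.
  move=> a; have [v _ <-] := lproj_surj (J := J) (Logic.I : setT a).
  have [t t0 vt] := uHA_bounded Hu v; exists t => //.
  by rewrite -(linvZ lp) -subv_ge0 -(linvB lp) lproj_wge0// subv_ge0.
- apply: strong_unitP; first exact: ler01.
  move=> a; exists `|a : R|; first exact: normr_ge0.
  have -> : `|a : R| *: (1 : R^o) = `|a : R| by exact: mulr1.
  exact: ler_norm.
apply: (@unital_iso_of_order_iso _ _ (vprod (lquotient J) R^o) _ _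
  (fun v => (lproj J v, phi v))).
- by move=> r x y; rewrite lp lphi.
- move=> [a r]; have [w _ <-] := lproj_surj (J := J) (Logic.I : setT a).
  (* Since e is 0 modulo J and phi e = 1, adding multiples of e changes only the second
     coordinate. *)
  exists (w + (r - phi w) *: e).
  rewrite (linvD lp) (linvZ lp) pie scaler0 addr0; congr (_, _).
  by rewrite (linvD lphi) (linvZ lphi) phie /GRing.scale /= mulr1 subrKC.
- move=> v; split=> [v0|/andP[/= v1 v2]].
    by apply/andP; split; [exact: lproj_wge0 | exact: phi_ge0].
  (* The negative part of v is in J by the first coordinate. It is in I too, as v is congruent to
     phi v u with phi v >= 0, and I and J meet only in 0. *)
  rewrite -oppv_le0 -posv_eq0; apply/eqP/IJ; first exact: posv_ge0.
    apply: (lideal_le (lideal_posv (lidealN (phiP v)))); first exact: posv_ge0.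
    by rewrite le_posv// opprB lev_wDl// scalev_ge0.
  exact/lproj_ge0.
- by rewrite phiu.
Qed.

End Atomless.

(** * The Cantor cube and trees of components *)

Section CantorCube.
Implicit Types (x y z : nat -> bool) (m n : nat).

Definition agree n x y := forall i, (i < n)%N -> x i = y i.

Lemma agree_sym n x y : agree n x y -> agree n y x.
Proof. by move=> xy i /xy. Qed.

Lemma agree_trans n x y z : agree n x y -> agree n y z -> agree n x z.
Proof. by move=> xy yz i li; rewrite xy// yz. Qed.

Lemma agreeW m n x y : (m <= n)%N -> agree n x y -> agree m x y.
Proof. by move=> mn xy i im; apply: xy; exact: leq_trans mn. Qed.

Lemma agreeS n x y : agree n.+1 x y <-> agree n x y /\ x n = y n.
Proof.
split=> [xy|[xy xyn] i]; first by split; [exact: agreeW xy | exact: xy].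
by rewrite ltnS leq_eqVlt => /predU1P[->//|/xy].
Qed.

(** The filter generated by the cylinders around x converges to x, because it does so in each
    coordinate. Conversely, a cylinder is a finite intersection of coordinate conditions. *)
Lemma nbhs_cube (x : cube nat) (A : set (cube nat)) :
  nbhs x A <-> exists n, forall y : cube nat, agree n x y -> A y.
Proof.
split.
  pose F := filter_from [set: nat] (fun n => [set y : cube nat | agree n x y]).
  have FF : Filter F.
    apply: filter_from_filter; first by exists 0%N.
    move=> i j _ _; exists (maxn i j) => // y xy.
    by split; apply: agreeW xy; rewrite ?leq_maxl ?leq_maxr.
  have : F --> x.
    apply/cvg_sup => i U.
    have /= -> := @nbhsE (initial_topology (fun f : nat -> bool => f i)) x.
    move=> -[B [[C oC <-] Cx] BU].
    exists i.+1 => // y xy; apply: BU; move: Cx.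
    by rewrite /preimage /= (xy i).
  by move=> Fx /Fx [n _ nA]; exists n => y /nA.
move=> [n nA]; suff cyl : \forall y \near x, agree n x y by apply: filterS cyl.
elim: n {nA} => [|n IH]; first by apply: (@nearW _ (nbhs x)) => y i.
have Hn : \forall y \near x, x n = y n.
  apply: (@proj_continuous nat (fun=> bool) n x [set b | x n = b]).
  by rewrite nbhs_principalE; exact/principal_filterP.
by near=> y; apply/agreeS; split; near: y.
Unshelve. all: by end_near. Qed.

(** Compactness of the cube, in its near-covering form for the filter of large n, turns local bounds
    into a uniform one. *)
Lemma cube_uniform (P : nat -> (nat -> bool) -> Prop) :
    (forall m n x, (m <= n)%N -> P m x -> P n x) ->
    (forall x, exists n, forall y, agree n x y -> P n y) ->
  exists n, forall x, P n x.
Proof.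
move=> Pm Pl.
have cpt : near_covering [set: cube nat].
  apply/compact_near_coveringP; exact: cantor_space_compact.
have := cpt nat \oo P _; case.
  move=> x _; have [m mP] := Pl x.
  exists ([set y : cube nat | agree m x y], [set n | (m <= n)%N]) => /=.
    split; first by apply/nbhs_cube; exists m.
    exact: nbhs_infty_ge.
  by move=> [y n] /= [xy mn]; apply: Pm mn _; exact: mP.
move=> n _ /(_ n (leqnn n)) nP; exists n => x; exact: nP.
Qed.

End CantorCube.

Section ComponentTree.
Variables (R : realType) (V : vectLatticeType R) (u : V).
Hypotheses (Hu : is_uHA u) (Hreal : no_real_factor u).
Implicit Types (v w e b c d : V) (x y z : nat -> bool) (m n : nat).

Let u_ge0 : 0 <= u. Proof. by case: Hu => _ []. Qed.

(** For components, the second case means e <= b. Written as disjointness, both cases pass to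
    smaller pieces. *)
Definition decides e b := e `&` b = 0 \/ e `&` (u - b) = 0.

Lemma decides_le e d b : component u b -> 0 <= d -> d <= e ->
  decides e b -> decides d b.
Proof.
move=> cb d0 de [eb|eb]; [left|right]; apply: meetv_eq0W eb => //.
  exact: component_ge0 cb.
exact: component_ge0 (componentC cb).
Qed.

Definition splitting e b c :=
  [/\ component u c, e `&` c != 0, e `&` (u - c) != 0,
      decides (e `&` c) b & decides (e `&` (u - c)) b].

(** If b cuts e into two nonzero pieces, take c = b. Otherwise e already decides b, and so do the
    pieces of any cut given by [atomless]. *)
Lemma splitting_ex e b : component u e -> e != 0 -> component u b ->
  exists c, splitting e b c.
Proof.
move=> ce en0 cb; have e0 := component_ge0 ce.
have [nd|[eb eb']] : decides e b \/ e `&` b != 0 /\ e `&` (u - b) != 0.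
    have [/eqP|eb] := boolP (e `&` b == 0); first by left; left.
    by have [/eqP|eb'] := boolP (e `&` (u - b) == 0); [left; right | right].
  have [c [cc ec ec']] := atomless Hu Hreal ce en0.
  have h d : component u d -> decides (e `&` d) b.
    move=> cd; apply: decides_le nd; rewrite ?leIl//.
    exact: component_ge0 (componentI ce cd).
  by exists c; split=> //; apply: h => //; exact: componentC.
have e0m : e `&` 0 = 0 by exact/meet_idPr.
exists b; split=> //; [right|left]; rewrite -meetA.
  by rewrite (cb : _ `&` _ = _).
by rewrite [_ `&` b]meetC (cb : _ `&` _ = _).
Qed.

(* The pieces at level n form a partition of u; each is cut into two nonzero
   pieces at level n + 1, so as to lie inside or outside the n-th component. *)
Lemma component_tree (b : nat -> V) : (forall n, component u (b n)) -> u != 0 ->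
  exists E : nat -> (nat -> bool) -> V,
    [/\ forall x, E 0%N x = u,
        forall n x, component u (E n x) /\ E n x != 0,
        forall n x y, agree n x y -> E n x = E n y,
        forall n x y, agree n x y -> x n != y n ->
          E n.+1 x `&` E n.+1 y = 0 /\ E n.+1 x + E n.+1 y = E n x &
        forall n x, decides (E n.+1 x) (b n)].
Proof.
move=> cb un0.
(* The default 0 never arises: [c] is applied to nonzero components e, for which a splitting
   exists. *)
pose c e d := xget 0 (splitting e d).
pose E := fix E n (x : nat -> bool) := if n is n'.+1 then
  E n' x `&` (if x n' then c (E n' x) (b n') else u - c (E n' x) (b n')) else u.
have cP e n : component u e -> e != 0 -> splitting e (b n) (c e (b n)).
  move=> ce en0; rewrite /c; case: xgetP => [//|h].
  by have [d /h] := splitting_ex ce en0 (cb n).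
have comp n x : component u (E n x) /\ E n x != 0.
  elim: n => [|n [IH1 IH2]] /=; first by split=> //; exact: componentT.
  have [cc ? ? _ _] := cP _ n IH1 IH2.
  by case: (x n); split=> //; apply: componentI => //; exact: componentC.
have Eag n x y : agree n x y -> E n x = E n y.
  by elim: n => [//|n IH] /agreeS[/IH /= -> ->].
exists E; split=> //.
- move=> n x y xy /=; rewrite -(Eag _ _ _ xy).
  have [c1 c2] := comp n x; have [cc _ _ _ _] := cP _ n c1 c2.
  case: (x n) (y n) => [] [] // _.
    by rewrite component_disjoint// component_split.
  rewrite [X in X = 0 /\ _]meetC [X in _ /\ X = _]addrC.
  by rewrite component_disjoint// component_split.
- move=> n x /=; have [c1 c2] := comp n x; have [_ _ _ d1 d2] := cP _ n c1 c2.
  by case: (x n).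
Qed.

End ComponentTree.

(** * Evaluation along the branches *)

Definition flip n (x : nat -> bool) : nat -> bool :=
  fun i => if i == n then ~~ x i else x i.

Lemma agree_flip n x : agree n x (flip n x).
Proof. by move=> i; rewrite /flip; case: eqP => // ->; rewrite ltnn. Qed.

Lemma flip_neq n x : x n != flip n x n.
Proof. by rewrite /flip eqxx; case: (x n). Qed.

(** Apply [cube_uniform] to the property that f is constant on the cylinder of length n around x. *)
Lemma LC_depth (R : realType) (f : LC_free R nat) :
  exists N, forall x y : nat -> bool, agree N x y -> f x = f y.
Proof.
apply: cube_uniform => [m n x mn fm y xy|x]; first by apply: fm; exact: agreeW xy.
have /asboolP/(_ x)/nbhs_cube[n fn] := LC_funP f; exists n => y xy z yz.
by rewrite !fn//; exact: agree_trans xy yz.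
Qed.

Section TreeRepresentation.
Variables (R : realType) (V : vectLatticeType R) (u : V).
Hypothesis Hu : is_uHA u.
Variable E : nat -> (nat -> bool) -> V.
Hypotheses (E0 : forall x, E 0%N x = u)
  (Ec : forall n x, component u (E n x) /\ E n x != 0)
  (Eag : forall n x y, agree n x y -> E n x = E n y)
  (Esplit : forall n x y, agree n x y -> x n != y n ->
    E n.+1 x `&` E n.+1 y = 0 /\ E n.+1 x + E n.+1 y = E n x)
  (Edec : forall e, component u e -> forall x, exists n, decides u (E n x) e).
Implicit Types (v w e b c d : V) (x y z : nat -> bool) (m n : nat) (r : R).

Let E_ge0 n x : 0 <= E n x. Proof. exact: component_ge0 (Ec n x).1. Qed.

Let E_le x : {homo E^~ x : m n / (m <= n)%N >-> n <= m}.
Proof.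
move=> m n; elim: n => [|n IH]; first by rewrite leqn0 => /eqP ->.
rewrite leq_eqVlt => /predU1P[->//|/IH]; apply: le_trans.
have [_ <-] := Esplit (@agree_flip n x) (flip_neq n x).
by rewrite lev_wDr.
Qed.

Let E_disjoint n x y : ~ agree n x y -> E n x `&` E n y = 0.
Proof.
elim: n => [|n IH] nxy; first by exfalso; apply: nxy.
have [xy|/IH] := pselect (agree n x y).
  by apply: (Esplit xy _).1; apply/eqP => xyn; apply: nxy; apply/agreeS.
by apply: meetv_eq0W => //; exact: E_le.
Qed.

(** Under the isomorphism to come, these are the functions that vanish at x, equivalently near x. *)
Definition branch_lideal x : lideal V :=
  LIdeal (is_lideal_disjoint (fun n => E_ge0 n x) (@E_le x)).

(** No piece is disjoint from u, and every component is decided along x, so [character_of_lideal]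
    applies. The uniqueness clause serves to compute values of the characters. *)
Lemma branch_character : exists phi : (nat -> bool) -> V -> R^o, forall x,
  [/\ linear (phi x), forall v, 0 <= v -> 0 <= phi x v,
      forall v, branch_lideal x (v - phi x v *: u) &
      forall v r, branch_lideal x (v - r *: u) -> phi x v = r].
Proof.
have u0 : 0 <= u by case: Hu => _ [].
suff ex x : exists phi : V -> R^o,
  [/\ linear phi, forall v, 0 <= v -> 0 <= phi v,
      forall v, branch_lideal x (v - phi v *: u) &
      forall v r, branch_lideal x (v - r *: u) -> phi v = r].
  by exists (fun x => sval (cid (ex x))) => x; case: cid.
have nIu : ~ branch_lideal x u.
  move=> [n]; rewrite ge0_absv// => Eu; have [cE /negP] := Ec n x; apply.
  by rewrite -Eu; apply/eqP/esym/meet_idPl/component_le.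
have [|phi [lphi phi_ge0 phiu phiP]] := character_of_lideal Hu nIu.
  move=> b cb; have [n [Eb|Eb]] := Edec cb x; [left|right]; exists n.
    by rewrite ge0_absv// (component_ge0 cb).
  by rewrite ge0_absv// (component_ge0 (componentC cb)).
exists phi; split=> // v r; exact: lideal_coef_uniq nIu (phiP v).
Qed.

Lemma iso_LC_of_tree : unital_iso u (LC_free1 R nat).
Proof.
have [phi phiP] := branch_character.
have lphi x : linear (phi x) by case: (phiP x).
have phiI x v : branch_lideal x (v - phi x v *: u) by case: (phiP x).
have phi_uniq x v r : branch_lideal x (v - r *: u) -> phi x v = r.
  by case: (phiP x) => _ _ _; apply.
(* The value at x is witnessed by a single piece [E n x], shared by all branches that agree with x
   up to n. *)
have lc v x : exists n, forall y, agree n x y -> phi y v = phi x v.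
  have [n nv] := phiI x v; exists n => y xy; apply: phi_uniq; exists n.
  by rewrite -(Eag xy).
have lcF v : (phi^~ v : cube nat -> R^o) \in @lc_pred R (cube nat).
  by apply/asboolP => x; apply/nbhs_cube; exact: lc.
have phi1 n x y : agree n x y -> phi y (E n x) = 1.
  move=> xy; apply: phi_uniq; exists n; rewrite scale1r (Eag xy) -absvN opprB.
  rewrite ge0_absv; last exact: component_ge0 (componentC (Ec n y).1).
  exact: (Ec n y).1.
have phi0 n x y : ~ agree n x y -> phi y (E n x) = 0.
  move=> xy; apply: phi_uniq; exists n; rewrite scale0r subr0 ge0_absv// meetC.
  exact: E_disjoint.
(* Induction on N - m reaches f cut down to the cylinder of length m around x. For m = N this is a
   multiple of [E m x]; otherwise add what is reached on the half cylinders of x and [flip m x]. *)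
have phi_onto N (f : (nat -> bool) -> R^o) : (forall x y, agree N x y -> f x = f y) ->
    forall m, (m <= N)%N -> forall x, exists v, forall y,
      (agree m x y -> phi y v = f y) /\ (~ agree m x y -> phi y v = 0).
  move=> fN m mN; have [k] := ubnP (N - m); elim: k m mN => // k IH m mN kN x.
  have [Nm|mltN] := leqP N m.
    exists (f x *: E m x) => y; split=> xy.
      rewrite (linvZ (lphi y)) phi1// (fN x y); first exact: mulr1.
      exact: agreeW xy.
    by rewrite (linvZ (lphi y)) phi0// scaler0.
  have kN' : (N - m.+1 < k)%N by rewrite -ltnS (leq_trans _ kN)// ltnS ltn_sub2l.
  have [v vP] := IH _ mltN kN' x; have [w wP] := IH _ mltN kN' (flip m x).
  exists (v + w) => y; rewrite (linvD (lphi y)).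
  have [v1 v0] := vP y; have [w1 w0] := wP y; split=> xy.
    have [xym|/eqP xym] := pselect (x m = y m).
      rewrite v1 ?w0 ?addr0//; last exact/agreeS.
      by move=> /agreeS[_]; rewrite -xym => /esym/eqP; apply/negP/flip_neq.
    rewrite v0 ?w1 ?add0r//; last by move=> /agreeS[_ /eqP]; apply/negP.
    apply/agreeS; split; first exact: agree_trans (agree_sym (@agree_flip m x)) xy.
    by rewrite /flip eqxx; case: (x m) (y m) xym => [] [].
  rewrite v0; last by move=> /agreeS[/xy].
  rewrite w0 ?addr0// => /agreeS[h _]; apply: xy.
  exact: agree_trans (@agree_flip m x) h.
apply: (@unital_iso_of_order_iso _ _ _ _ _ (fun v => MkLC (lcF v) : LC_free R nat)).
- by move=> r v w; apply: val_inj; apply/funext => x; exact: lphi.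
- move=> f; have [N fN] := LC_depth f.
  have [v fv] := phi_onto N f fN 0%N (leq0n N) (fun=> true).
  by exists v; apply: val_inj; apply/funext => x; exact: (fv x).1.
- move=> v; split=> [v0|/LC_leP v0].
    by apply/LC_leP => x; have [_ phi_ge0 _ _] := phiP x; exact: phi_ge0.
  (* By compactness one level n has all its pieces disjoint from v^-. Summing pieces down to level 0
     makes u disjoint from v^-, which is then 0. *)
  have [n nv] : exists n, forall x, E n x `&` posv (- v) = 0.
    apply: cube_uniform => [m n x mn|x].
      by apply: meetv_eq0W => //; [exact: posv_ge0 | exact: E_le].
    have [n nv] := lideal_posv (lidealN (phiI x v)); exists n => y xy.
    rewrite -(Eag xy); apply: meetv_eq0W nv => //; first exact: posv_ge0.
    rewrite (ge0_absv (posv_ge0 _)) le_posv// opprB lev_wDl//.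
    by apply: scalev_ge0; [exact: v0 | case: Hu => _ []].
  have {nv} : forall x, E 0%N x `&` posv (- v) = 0.
    elim: n nv => [//|n IH] nv; apply: IH => x.
    have [_ <-] := Esplit (@agree_flip n x) (flip_neq n x).
    by rewrite meetC; apply: meetvD_eq0; rewrite meetC.
  move=> /(_ (fun=> true)); rewrite E0; have [_ [_ wu]] := Hu => /wu/eqP.
  by rewrite posv_eq0 oppv_le0.
- apply: val_inj; apply/funext => x; apply: phi_uniq.
  rewrite scale1r subrr; exact: lideal0.
Qed.

End TreeRepresentation.

(** * Locally constant functions on the Cantor cube *)

Section VlatHom.
Variables (R : realType) (V W : vectLatticeType R) (f : V -> W).
Hypothesis hf : vlat_hom f.

Lemma vlat_hom_le x y : x <= y -> f x <= f y.
Proof. by have [_ fI _] := hf; move=> /meet_idPl {1}<-; rewrite fI leIr. Qed.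

Lemma vlat_hom_posv x : f (posv x) = posv (f x).
Proof. by have [lf _ fU] := hf; rewrite /posv fU (linv0 lf). Qed.

End VlatHom.

Section LocallyConstantOnCube.
Variable R : realType.
Local Notation LCN := (LC_free R nat).
Implicit Types (f g d e v w : LCN) (x y : nat -> bool).

Lemma LC_ge0P f : 0 <= f <-> forall x, 0 <= f x :> R.
Proof. by split=> [/LC_leP|h]; last exact/LC_leP. Qed.

Lemma LC_meet f g x : (f `&` g : LCN) x = Num.min (f x : R) (g x).
Proof. by rewrite -meetEtotal. Qed.

Lemma LC_join f g x : (f `|` g : LCN) x = Num.max (f x : R) (g x).
Proof. by rewrite -joinEtotal. Qed.

Lemma LC_absv v x : (absv v : LCN) x = `|v x : R|.
Proof. by rewrite LC_join; exact: maxrN. Qed.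

(** Suppose that n v <= w for all n >= 1 in an image, and lift v to a^+ and w to b. By compactness
    a^+ <= ((n + 1) a^+ - b)^+ for some n; the image of the right side is ((n + 1) v - w)^+ = 0, so
    v <= 0. *)
Lemma LC_is_uHA : is_uHA (LC_free1 R nat).
Proof.
split; last first.
  split; first by apply/LC_leP => x; exact: ler01.
  move=> v /(congr1 (fun f : LCN => f _)) v0; apply: val_inj; apply/funext => x.
  have := v0 x; rewrite LC_meet /=; case: leP => // _ /eqP; by rewrite oner_eq0.
move=> W h hh hsurj v w v0 vw; apply: contrapT => harch.
have {}harch n : v *+ n.+1 <= w.
  by apply: contrapT => /negP nv; apply: harch; exists n.+1.
have [lh _ _] := hh.
have [a _ hav] := hsurj v Logic.I; have [b _ hbw] := hsurj w Logic.I.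
have hpa : h (posv a) = v by rewrite vlat_hom_posv// hav posv_id// ltW.
have [n nP] : exists n, forall x,
    posv a x = 0 \/ (posv a x + b x : R) <= n.+1%:R * (posv a x : R).
  have [N aN] := LC_depth (posv a); have [M bM] := LC_depth b.
  have a0 x : 0 <= (posv a x : R) by have /LC_ge0P := posv_ge0 a.
  apply: cube_uniform => [m n x mn [->|h1]|x]; [by left| |].
    by right; apply: (le_trans h1); rewrite ler_wpM2r// ler_nat ltnS.
  have := a0 x; rewrite le_eqVlt => /predU1P[ax|ax].
    exists N => y xy; left; by rewrite -(aN x).
  pose n := Num.bound `|(posv a x + b x : R) / (posv a x : R)|.
  exists (maxn n (maxn N M)) => y xy; right.
  rewrite -(aN x); last by apply: agreeW xy; rewrite !leq_max leqnn orbT.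
  rewrite -(bM x); last by apply: agreeW xy; rewrite !leq_max leqnn !orbT.
  rewrite -ler_pdivrMr//; apply: (le_trans (ler_norm _)).
  by rewrite (le_trans (ltW (archi_boundP (normr_ge0 _))))// ler_nat leqW// leq_maxl.
have an : posv a <= posv (n.+1%:R *: posv a - b).
  apply/LC_leP => x.
  have -> : posv (n.+1%:R *: posv a - b) x =
      Num.max (n.+1%:R * (posv a x : R) - (b x : R)) 0 :> R by exact: LC_join.
  suff pax : (posv a x : R) <= Num.max (n.+1%:R * (posv a x : R) - (b x : R)) 0.
    exact: pax.
  by rewrite le_max lerBrDr; case: (nP x) => ->; rewrite ?lexx ?orbT.
have := vlat_hom_le hh an.
rewrite hpa vlat_hom_posv// (linvB lh) (linvZ lh) hpa hbw scaler_nat.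
have /eqP -> : posv (v *+ n.+1 - w) == 0 by rewrite posv_eq0 lev_BlDr add0r.
by move=> /le_gtF; rewrite v0.
Qed.

(** A factor R would give e > 0 such that every d between 0 and e is a multiple of e. Cutting e
    along a coordinate N on which it does not depend gives a d that is not. *)
Lemma LC_no_real_factor : no_real_factor (LC_free1 R nat).
Proof.
move=> [V' [u' [[V0 [u0 [_ [u'0 _] [f [g [[hf fu] [hg gu] fg gf]]]]]]
  [k [k' [[hk ku] [hk' ku'] kk' k'k]]]]]].
have [lf _ _] := hf; have [lg _ _] := hg; have [lk' _ _] := hk'; have [lk _ _] := hk.
pose e : LCN := g (0, u').
have e_ne0 : e <> 0.
  move=> e0; have : f e = 0 by rewrite e0 linv0.
  rewrite /e gf => -[] u'_0; move: ku; rewrite u'_0 (linv0 lk) => /esym/eqP.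
  by rewrite oner_eq0.
have line d : 0 <= d -> d <= e -> exists t : R, d = t *: e.
  move=> /(vlat_hom_le hf); rewrite (linv0 lf) => d0 /(vlat_hom_le hf).
  rewrite /e gf => de; exists (k (f d).2 : R).
  rewrite -(linvZ lg) -[LHS]fg; congr g.
  case: (f d) d0 de => p q /andP[/= p0 q0] /andP[/= p1 q1].
  have -> : p = 0 by apply/le_anti; rewrite p0 p1.
  congr (_, _); first by rewrite scaler0.
  rewrite -[LHS]kk' -[in RHS]ku' -(linvZ lk'); congr k'.
  by rewrite /GRing.scale /= mulr1.
have [x0 ex0] : exists x, e x <> 0.
  apply: contrapT => h; apply: e_ne0; apply: val_inj; apply/funext => x.
  by apply: contrapT => ex; apply: h; exists x.
have [N eN] := LC_depth e.
have e0 x : 0 <= (e x : R).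
  have /LC_ge0P : 0 <= e; last exact.
  rewrite -(linv0 lg); apply: (vlat_hom_le hg); apply/andP; split=> //.
have lcd : ((fun y => if y N == x0 N then e y else 0) : cube nat -> R^o)
    \in @lc_pred R (cube nat).
  apply/asboolP => x; apply/nbhs_cube; exists N.+1 => y /agreeS[xy xyN].
  by rewrite -xyN -(eN x).
pose d : LCN := MkLC lcd.
have [t dt] : exists t : R, d = t *: e.
  apply: line; apply/LC_leP => x; rewrite /d /=; case: ifP => // _; exact: e0.
have dE x : (if x N == x0 N then e x else 0) = t * (e x : R) :> R.
  by have := congr1 (fun f : LCN => f x) dt.
(* Here d vanishes, but e has the same value as at x0, where d and e coincide; hence e x0 = 0. *)
have := dE (flip N x0); rewrite eq_sym (negbTE (flip_neq N x0)).
rewrite -(eN x0); last exact: agree_flip.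
by rewrite -dE eqxx => /esym.
Qed.

Lemma polar_LC v : polar v = [set w : LCN | forall x, v x = 0 \/ w x = 0].
Proof.
apply/seteqP; split=> w.
  move=> /(congr1 (fun f : LCN => f _)) vw x; have := vw x.
  rewrite LC_meet !LC_absv minEle; case: ifP => _ /normr0_eq0 h; [left | right]; exact: h.
move=> vw; apply: val_inj; apply/funext => x; apply: (etrans (LC_meet _ _ _)).
rewrite !LC_absv; case: (vw x) => ->; rewrite normr0; [apply/min_idPl | apply/min_idPr];
  exact: normr_ge0.
Qed.

(** The polar of v depends only on the support of v, a finite union of cylinders, and a finite list
    of binary words encodes it. *)
Lemma LC_countable_polars : countable (principal_polars LCN).
Proof.
pose code (s : seq (seq bool)) : set LCN :=
  [set w | forall x, has (fun p => p == mkseq x (size p)) s -> w x = 0].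
apply: (sub_countable _ (countableP [set: seq (seq bool)])).
apply: card_le_trans (card_image_le code _).
apply: subset_card_le => A [v _ <-].
have [N vN] := LC_depth v.
(* These are the words of length N on whose cylinder v is nonzero, tested at the extension by
   [false]. *)
exists [seq p <- [seq val t | t <- enum {: N.-tuple bool}] | v (nth false p) != 0] => //.
rewrite polar_LC; apply/esym/seteqP; split=> w vw x.
  move=> /hasP[p]; rewrite mem_filter => /andP[vp /mapP[t _ pt]] /eqP px.
  have [vx|//] := vw x; case/eqP: vp; rewrite -vx; apply: vN => i iN.
  by rewrite px nth_mkseq// pt size_tuple.
have [vx|/eqP vx] := pselect (v x = 0); [by left|right].
apply: vw; apply/hasP; exists (mkseq x N); last by rewrite size_mkseq.
rewrite mem_filter; apply/andP; split.
  rewrite (vN _ x)// => i iN; exact: nth_mkseq.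
by apply/mapP; exists [tuple of mkseq x N]; rewrite ?mem_enum.
Qed.

End LocallyConstantOnCube.

Theorem corollary6p6 (R : realType) :
  [/\ is_uHA (LC_free1 R nat),
      aleph0_conditions (LC_free1 R nat) &
      forall (V : vectLatticeType R) (u : V),
        is_uHA u -> aleph0_conditions u -> unital_iso u (LC_free1 R nat)].
Proof.
split; first exact: LC_is_uHA.
  split; [|exact: LC_no_real_factor|exact: LC_countable_polars].
  apply/eqP => /(congr1 (fun f : LC_free R nat => f (fun=> true))) /eqP.
  by rewrite oner_eq0.
move=> V u Hu [un0 hreal hcount]; have [_ [u0 _]] := Hu.
have [b [cb b_onto]] := component_enum u0 hcount.
have [E [E0 Ec Eag Esplit Edec]] := component_tree Hu hreal cb un0.
apply: (iso_LC_of_tree Hu E0 Ec Eag Esplit) => e /b_onto[n <-] x.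
by exists n.+1.
Qed.
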